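(* There is a set of reals $X\subseteq\mathbb{R}$ (with the subspace topology) such that every finite power $X^k$ ($k\ge 1$) is Hurewicz, but $X$ is not productively Lindelöf (and hence $X$ is not Alster).
   Context: A topological space is productively Lindelöf if its product with every Lindelöf space is Lindelöf. A point-cofinite cover of a space is an infinite open cover such that each point belongs to all but finitely many members of the cover. A space $X$ is Hurewicz if for each sequence $\{\mathcal{U}_n\}_{n<\omega}$ of open covers of $X$ without finite subcovers there are finite $\mathcal{F}_n\subseteq\mathcal{U}_n$ such that $\{\bigcup\mathcal{F}_n : n<\omega\}$ is a point-cofinite cover of $X$. A space $X$ is Alster if every cover of $X$ by $G_\delta$ sets such that each compact subset of $X$ is included in some member of the cover has a countable subcover. *)

(* Defs.v *)
From HB Require Import structures.
From mathcomp Require Import all_boot all_order all_algebra.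
From mathcomp Require Import all_classical all_reals all_analysis.
Set Implicit Arguments. Unset Strict Implicit. Unset Printing Implicit Defensive.
Import Order.TTheory GRing.Theory Num.Theory.
Import numFieldTopology.Exports.
Local Open Scope classical_set_scope.

(* Subspace topology on a subset A of a topological space T is represented
   by its open sets: the traces A `&` O of open sets O of T. *)
Definition ropen (T : topologicalType) (A V : set T) : Prop :=
  exists O : set T, open O /\ V = A `&` O.

Definition open_cover (T : topologicalType) (A : set T) (U : set (set T)) : Prop :=
  (forall V, U V -> ropen A V) /\ A `<=` \bigcup_(V in U) V.

Definition Lindelof (T : topologicalType) (A : set T) : Prop :=
  forall U, open_cover A U ->
    exists C, C `<=` U /\ countable C /\ A `<=` \bigcup_(V in C) V.

Definition no_finite_subcover (T : topologicalType) (A : set T) (U : set (set T)) : Prop :=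
  ~ (exists F, F `<=` U /\ finite_set F /\ A `<=` \bigcup_(V in F) V).

Definition point_cofinite_cover (T : topologicalType) (A : set T) (U : set (set T)) : Prop :=
  open_cover A U /\ infinite_set U /\
  (forall x, A x -> finite_set [set V | U V /\ ~ V x]).

Definition Hurewicz (T : topologicalType) (A : set T) : Prop :=
  forall U : nat -> set (set T),
    (forall n, open_cover A (U n) /\ no_finite_subcover A (U n)) ->
    exists F : nat -> set (set T),
      (forall n, F n `<=` U n /\ finite_set (F n)) /\
      point_cofinite_cover A (range (fun n => \bigcup_(V in F n) V)).

Definition productively_Lindelof (T : topologicalType) (A : set T) : Prop :=
  forall Y : topologicalType, Lindelof [set: Y] -> Lindelof (A `*` [set: Y]).

Definition rGdelta (T : topologicalType) (A G : set T) : Prop :=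
  exists O : nat -> set T, (forall n, ropen A (O n)) /\ G = \bigcap_n O n.

(* The subspace A is Alster.  (A subset K of A is compact in the subspace A
   iff it is compact in T.) *)
Definition Alster (T : topologicalType) (A : set T) : Prop :=
  forall U : set (set T),
    (forall G, U G -> rGdelta A G) ->
    A `<=` \bigcup_(G in U) G ->
    (forall K, K `<=` A -> compact K -> exists2 G, U G & K `<=` G) ->
    exists C, C `<=` U /\ countable C /\ A `<=` \bigcup_(G in C) G.

(* The finite power X^k, as a subset of R^k = {ptws 'I_k -> R} with the
   product topology. *)
Definition power (R : realType) (X : set R) (k : nat) : set {ptws 'I_k -> R} :=
  [set f | forall i : 'I_k, X (f i)].
Arguments power {R} X k.

(* Main.v *)
From HB Require Import structures.
Require Import Defs.
From mathcomp Require Import all_boot all_order all_algebra.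
From mathcomp Require Import all_classical all_reals all_analysis.
From mathcomp Require Import wochoice lra.
Import Order.TTheory GRing.Theory Num.Theory.
Import numFieldTopology.Exports.
Local Open Scope classical_set_scope.

(** Identify [nat -> bool] with the power set of the natural numbers, embedded in
    the line by ternary expansions.  Take an unbounded family [b] of increasing
    functions, well ordered by eventual domination and indexed by a well-order of
    least possible length, and let [X] consist of the finite sets and of the ranges
    of the functions [b w].

    Finite powers are Hurewicz: the sets of size at most [m] form a compact set, so
    finitely many members of a cover already contain all the sets that meet the
    first [h m] integers in at most [m] points.  Some [b a] exceeds [h] infinitely
    often, hence so does every later [b w], which takes care of all points after
    [a]; the points before [a] are too few to be unbounded.

    Compact subsets of [X] are countable: otherwise the perfect set theorem yields a
    copy of the Cantor set inside [X] avoiding the finite sets and dominated by a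
    single function, so all its points come before a fixed index, which therefore
    has as many predecessors as there are functions, contradicting minimality.
    As [X] is uncountable, it is not Alster, and its product with Michael's line
    (the reals with the points of [X] isolated) is not Lindelof. *)

(** * A scale of minimal length *)

Local Notation "f <=* g" := (\forall n \near \oo, (f n <= g n)%N)
  (at level 70, no associativity).

Lemma not_dominated_ltn (f g : nat -> nat) (N : nat) :
  ~ (f <=* g) -> exists2 n, (N <= n)%N & (g n < f n)%N.
Proof.
move=> nfg; apply: contrapT => h; apply: nfg.
exists N => // n /= Nn; rewrite leqNgt; apply/negP => gf.
by apply: h; exists n.
Qed.

Lemma countable_family_dominated (F : nat -> nat -> nat) :
  exists g : nat -> nat, forall i, F i <=* g.
Proof.
exists (fun n => \max_(i < n.+1) F i n) => i.
exists i => // n /= lein.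
exact: (@leq_bigmax _ (fun j : 'I_n.+1 => F j n) (Ordinal (lein : i < n.+1)%N)).
Qed.

(** The strict order negates the converse of a well-order [r]. Minima of subsets give accessibility;
    uniqueness of the minimum of a pair gives trichotomy. *)
Lemma exists_well_founded_total (T : eqType) :
  exists lt : T -> T -> Prop,
    well_founded lt /\ forall v w, [\/ lt v w, v = w | lt w v].
Proof.
have [r wor] := well_ordering_principle T.
exists (fun v w => ~~ r w v); split.
- move=> w; apply: contrapT => nw.
  have [|z [[/asboolP nz zmin] _]] := wor (fun v => `[< ~ Acc (fun v w => ~~ r w v) v >]).
    by exists w; apply/asboolP.
  apply: nz; constructor => y rzy; apply: contrapT => ny.
  by move/negP: rzy; apply; apply: zmin; apply/asboolP.
- move=> v w.
  have rr u : r u u.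
    have [|z [[/eqP zu zmin] _]] := wor (pred1 u); first by exists u; apply/eqP.
    by move: (zmin u); rewrite zu; apply; rewrite inE.
  case: (boolP (r w v)) => [rwv|]; last by move=> ?; exact: Or31.
  case: (boolP (r v w)) => [rvw|]; last by move=> ?; exact: Or33.
  apply: Or32.
  have [|z [_ zuniq]] := wor (pred2 v w); first by exists v; rewrite inE eqxx.
  have zv : z = v.
    apply: zuniq; split; first by rewrite inE eqxx.
    by move=> y; rewrite !inE => /orP[] /eqP ->.
  have zw : z = w.
    apply: zuniq; split; first by rewrite inE eqxx orbT.
    by move=> y; rewrite !inE => /orP[] /eqP ->.
  by rewrite -zv.
Qed.

(** The successor keeps every summand positive, so the sums increase strictly even where [f]
    vanishes. *)
Definition strict_majorant (f : nat -> nat) (n : nat) : nat :=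
  \sum_(i < n.+1) (f i).+1.

Lemma strict_majorant_lt (f : nat -> nat) :
  {homo strict_majorant f : m n / (m < n)%N}.
Proof.
apply: homo_ltn; first exact: ltn_trans.
by move=> n; rewrite /strict_majorant [X in (_ < X)%N]big_ord_recr /= addnS ltnS leq_addr.
Qed.

Lemma strict_majorant_ge (f : nat -> nat) n : (f n <= strict_majorant f n)%N.
Proof. by rewrite /strict_majorant big_ord_recr /= addnS leqW// leq_addl. Qed.

(** Known as a b-scale, for the bounding number b. The field [scale_small] says without cardinals
    that every index has fewer than b predecessors. *)
Record scale (W : Type) (lt : W -> W -> Prop) (b : W -> nat -> nat) : Prop := Scale {
  scale_total : forall v w, [\/ lt v w, v = w | lt w v];
  scale_incr : forall w, {homo b w : m n / (m < n)%N};
  scale_mono : forall v w, lt v w -> b v <=* b w;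
  scale_unbounded : forall g, exists w, ~ (b w <=* g);
  scale_small : forall w (F : W -> nat -> nat),
    exists g, forall v, lt v w -> F v <=* g }.
Arguments scale {W}.
Arguments scale_total {W lt b}.
Arguments scale_incr {W lt b}.
Arguments scale_mono {W lt b}.
Arguments scale_unbounded {W lt b}.
Arguments scale_small {W lt b}.

(* The index set is a shortest possible one: either all of [nat -> nat], or the
   initial segment below the least index whose predecessors carry an unbounded
   family. *)
Lemma exists_scale : exists (W : Type) (lt : W -> W -> Prop) (b : W -> nat -> nat),
  scale lt b.
Proof.
set T := (nat -> nat).
have [lt [ltwf lttot]] := exists_well_founded_total T.
pose small w := forall F : T -> T, exists g, forall v, lt v w -> F v <=* g.
have [D [F [Dsmall Funb]]] : exists (D : set T) (F : T -> T),
    (forall w, D w -> small w) /\ (forall g, exists2 w, D w & ~ (F w <=* g)).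
  have [allsmall|] := pselect (forall w, small w).
    (* The family of all functions is unbounded: no [g] dominates [g + 1]. *)
    exists setT, id; split => // g; exists (fun n => (g n).+1) => //.
    by case=> N _ /(_ N (leqnn N)); rewrite /= ltnn.
  move=> /existsNP[w1 nw1].
  have [w0 nw0 w0min] : exists2 w0, ~ small w0 & forall v, lt v w0 -> small v.
    elim/(well_founded_ind ltwf): w1 nw1 => w IH nw.
    have [h|/existsNP[v /not_implyP[vw nv]]] := pselect (forall v, lt v w -> small v).
      by exists w.
    exact: IH nv.
  move/existsNP: nw0 => [F nF].
  exists [set v | lt v w0], F; split => // g; apply: contrapT => h.
  apply: nF; exists g => v vw; apply: contrapT => nv; apply: h.
  by exists v.
(* The recursion runs over all of [T]. Outside [D] the earlier values may have no common bound, and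
   [get] then returns a default; only indices in [D] are kept. *)
pose step w (rec : forall v, lt v w -> T) : T :=
  strict_majorant (fun n => maxn (F w n)
    (get [set g : T | forall v (vw : lt v w), rec v vw <=* g] n)).
pose b : T -> T := Fix ltwf (fun _ => T) step.
have bE w : b w = strict_majorant (fun n => maxn (F w n)
    (get [set g : T | forall v, lt v w -> b v <=* g] n)).
  rewrite /b Fix_eq// => u f g fg.
  suff -> : f = g by [].
  by apply: functional_extensionality_dep => v; apply: funext => vu.
have bF w : F w <=* b w.
  by near=> n; rewrite bE; apply: leq_trans (strict_majorant_ge _ _); exact: leq_maxl.
exists {w : T | D w}, (fun v w => lt (sval v) (sval w)), (fun w => b (sval w)).
split.
- move=> [v Dv] [w Dw] /=; have [vw|vw|wv] := lttot v w; [exact: Or31| |exact: Or33].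
  by apply: Or32; subst w; congr exist; exact: Prop_irrelevance.
- by move=> w; rewrite bE; exact: strict_majorant_lt.
- move=> v [w Dw] /= vw.
  have [g0 g0P] := Dsmall _ Dw b.
  have gP := @getPex T [set g : T | forall v, lt v w -> b v <=* g] (ex_intro _ g0 g0P).
  have {}gP := gP _ vw.
  near=> n; rewrite [b w]bE; apply: leq_trans (strict_majorant_ge _ _).
  rewrite leq_max; apply/orP; right.
  by near: n.
- move=> g; have [w Dw nw] := Funb g; exists (exist _ w Dw) => /= bwg; apply: nw.
  by near=> n; apply: (@leq_trans (b w n)); near: n.
- move=> [w Dw] G.
  pose G' (v : T) : T := if pselect (D v) is left Dv then G (exist _ v Dv) else fun=> 0%N.
  have [g gP] := Dsmall _ Dw G'.
  exists g => -[v Dv] /= vw; move: (gP _ vw); rewrite /G'.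
  by case: pselect => // Dv'; rewrite (Prop_irrelevance Dv Dv').
Unshelve. all: by end_near. Qed.

(** * Finite powers of the scale set *)

Definition cnt (x : nat -> bool) (M : nat) : nat := \sum_(i < M) x i.

Lemma cntS x M : cnt x M.+1 = (cnt x M + x M)%N.
Proof. by rewrite /cnt big_ord_recr. Qed.

Lemma cnt_leq x : {homo cnt x : m n / (m <= n)%N}.
Proof.
by apply: homo_leq => [m|m n p|n]; [exact: leqnn|exact: leq_trans|rewrite cntS leq_addr].
Qed.

Lemma eq_cnt x y M : (forall n, (n < M)%N -> x n = y n) -> cnt x M = cnt y M.
Proof. by move=> xy; apply: eq_bigr => i _; rewrite xy. Qed.

Definition finitely_supported (x : nat -> bool) := exists m, forall M, (cnt x M <= m)%N.

Definition range_point (f : nat -> nat) : nat -> bool := fun i => `[< range f i >].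

(** Values below [f m] come from arguments below [m]. In the induction a new element [M = f n]
    forces [n < m], and the hypothesis is applied to [n] instead of [m]. *)
Lemma cnt_range_point f m M : {homo f : m n / (m < n)%N} -> (M <= f m)%N ->
  (cnt (range_point f) M <= m)%N.
Proof.
move=> finc; elim: M m => [|M IH] m Mfm; first by rewrite /cnt big_ord0.
rewrite cntS /range_point; case: asboolP => [[n _ fnM]|_]; last first.
  by rewrite addn0 IH// ltnW.
rewrite addn1; have nm : (n < m)%N.
  rewrite ltnNge; apply/negP; rewrite leq_eqVlt => /orP[/eqP mn|/finc].
    by move: Mfm; rewrite mn fnM ltnn.
  by rewrite fnM => /(ltn_trans Mfm); rewrite ltnn.
by apply: leq_ltn_trans nm; apply: IH; rewrite fnM.
Qed.

Lemma range_point_unbounded f m : {homo f : m n / (m < n)%N} ->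
  exists M, (m < cnt (range_point f) M)%N.
Proof.
move=> finc; exists (f m).+1; elim: m => [|m IH];
  rewrite cntS {2}/range_point asboolT; try by [eexists|].
- by rewrite addn1.
- by rewrite addn1 ltnS; apply: leq_trans IH _; apply: cnt_leq; exact: finc.
Qed.

Section FinitePowers.
Variable I : finType.
Implicit Types (x y : I -> nat -> bool) (O : set (I -> nat -> bool)).

Definition agree L x y := forall i n, (n < L)%N -> x i n = y i n.

Definition cylinder_open O := forall x, O x -> exists L, forall y, agree L x y -> O y.

(** Merging the two indices into one makes this Tychonoff's theorem for a power of [bool]. *)
Lemma cluster_point (u : nat -> I -> nat -> bool) :
  exists x, forall L N, exists2 n, (N <= n)%N & agree L (u n) x.
Proof.
pose K := (I * nat)%type.
have cpt : compact [set: {ptws K -> bool}].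
  have := @tychonoff K (fun=> bool) (fun=> setT) (fun=> bool_compact).
  by congr compact; rewrite eqEsubset; split.
pose v n : {ptws K -> bool} := fun p => u n p.1 p.2.
have [z [_ zcl]] := cpt (v @ \oo) _ filterT.
exists (fun i n => z (i, n)) => L N.
have nz : nbhs z [set y : {ptws K -> bool} | forall i n, (n < L)%N -> y (i, n) = z (i, n)].
  have : \forall y \near z, forall p : I * 'I_L, y (p.1, val p.2) = z (p.1, val p.2).
    apply: (@filter_forall _ (I * 'I_L)%type
      (fun p (y : {ptws K -> bool}) => y (p.1, val p.2) = z (p.1, val p.2))
      (nbhs z) (nbhs_filter z)) => -[i n].
    exact: (@proj_continuous K (fun=> bool) (i, val n) z [set z (i, val n)]
      (discrete_set1 _)).
  by apply: filterS => y yz i n nL; exact: (yz (i, Ordinal nL)).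
have vN : (v @ \oo) [set v n | n in [set n | (N <= n)%N]].
  by exists N => // n /= Nn; exists n.
have [_ [[n Nn <-] vz]] := zcl _ _ vN nz.
by exists n => // i k kL; exact: vz.
Qed.

(* Quantitative compactness of the product of the sets [|x| <= m] (over the
   coordinates in [J]) and singletons (over the others). *)
Lemma bounded_cnt_box_covered (J : {set I}) p m (O : nat -> set (I -> nat -> bool)) :
  (forall c, cylinder_open (O c)) -> (forall c d, (c <= d)%N -> O c `<=` O d) ->
  (forall x, (forall i, if i \in J then (forall M, (cnt (x i) M <= m)%N)
      else x i = p i) -> exists c, O c x) ->
  exists c, forall x,
    (forall i, if i \in J then is_true (cnt (x i) c <= m)%N else x i = p i) -> O c x.
Proof.
move=> oO Omono cov; apply: contrapT => /forallNP nc.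
(* A counterexample [u c] satisfies the bound only below [c], but a cluster point lies in the box
   itself, hence in some [O c]. That open set then contains some [u n] with [n >= c], against
   monotonicity. *)
have /choice[u uP] : forall c, exists x,
    (forall i, if i \in J then is_true (cnt (x i) c <= m)%N else x i = p i) /\ ~ O c x.
  by move=> c; have /existsNP[x /not_implyP[]] := nc c; exists x.
have [x xP] := cluster_point u.
have [c Ocx] : exists c, O c x.
  apply: cov => i; case: ifPn => [iJ M|iJ].
    have [n Mn unx] := xP M M.
    have := (uP n).1 i; rewrite iJ => cn.
    rewrite -(eq_cnt (u n i)) => [|k]; last exact: unx.
    exact: leq_trans (cnt_leq _ _ _ Mn) cn.
  apply: funext => k; have [n _ unx] := xP k.+1 0%N.
  by rewrite -(unx i k)//; have := (uP n).1 i; rewrite (negbTE iJ) => ->.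
have [L Lx] := oO _ _ Ocx.
have [n cn unx] := xP L c.
apply: (uP n).2; apply: (Omono c) => //; apply: Lx => i k kL.
by rewrite unx.
Qed.

(** Covers are listed as sequences and finite selections are initial segments, so that selections
    are functions that can be compared by domination. *)
Definition Hurewicz_enum (A : set (I -> nat -> bool)) :=
  forall U : nat -> nat -> set (I -> nat -> bool),
    (forall n i, cylinder_open (U n i)) -> (forall n, A `<=` \bigcup_i U n i) ->
    exists f : nat -> nat, forall x, A x ->
      \forall n \near \oo, exists2 i, (i < f n)%N & U n i x.

Section Scale.
Variables (W : Type) (lt : W -> W -> Prop) (b : W -> nat -> nat).
Hypothesis bscale : scale lt b.

Definition scale_set (x : nat -> bool) : Prop :=
  finitely_supported x \/ exists w, x = range_point (b w).

(* Induction on the number of free coordinates: once an index [a] is fixed whose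
   function escapes the gauge [h] infinitely often, a coordinate beyond [a] is
   handled by compactness, and a coordinate before [a] takes too few values to
   matter. *)
Lemma Hurewicz_enum_box (J : {set I}) p :
  Hurewicz_enum [set x | forall i, if i \in J then scale_set (x i) else x i = p i].
Proof.
have [k] := ubnP #|J|; elim: k J p => // k IH J p Jk U oU covU.
(* [h m] serves all covers [j <= m] at once, because cover [n] will be treated with the gauge at a
   later place [s n >= n]. *)
have [h hP] : exists h : nat -> nat, forall m j, (j <= m)%N -> forall x,
    (forall i, if i \in J then is_true (cnt (x i) (h m) <= m)%N else x i = p i) ->
    exists2 i, (i < h m)%N & U j i x.
  suff H : forall m j, exists c, forall d, (c <= d)%N -> forall x,
    (forall i, if i \in J then is_true (cnt (x i) d <= m)%N else x i = p i) ->
    exists2 i, (i < d)%N & U j i x.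
    have /choice[c cP] : forall m, exists c : nat -> nat, forall j d, (c j <= d)%N -> forall x,
      (forall i, if i \in J then is_true (cnt (x i) d <= m)%N else x i = p i) ->
      exists2 i, (i < d)%N & U j i x by move=> m; have /choice[c cP] := H m; exists c.
    exists (fun m => \max_(j < m.+1) c m j) => m j jm; apply: cP.
    exact: (@leq_bigmax _ (fun j : 'I_m.+1 => c m j) (Ordinal (jm : j < m.+1)%N)).
  move=> m j.
  have [| | |c cP] := @bounded_cnt_box_covered J p m
    (fun c => [set x | exists2 i, (i < c)%N & U j i x]).
  - move=> c x [i ic /oU[L LP]]; exists L => y /LP Uy; by exists i.
  - move=> c d cd x [i ic Ux]; exists i => //; exact: leq_trans cd.
  - move=> x xP; have [|i _ Ux] := covU j x; last by exists i.+1, i.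
    by move=> i; have := xP i; case: ifP => // _ xm; left; exists m.
  exists c => d cd x xd.
  have [|i ic Ux] := cP x; last by exists i => //; exact: leq_trans cd.
  move=> i; have := xd i; case: ifP => // _; apply: leq_trans.
  exact: cnt_leq.
have [a na] := scale_unbounded bscale h.
have /choice[s sP] : forall j, exists m, (j <= m)%N /\ (h m < b a m)%N.
  by move=> j; have [m jm hm] := not_dominated_ltn _ _ j na; exists m.
(* Freezing one coordinate at [range_point (b v)] lowers the number of free ones, so the induction
   hypothesis yields [f v]; [scale_small] then bounds these functions for all [v] before [a]. *)
have /choice[f fP] : forall v, exists f : nat -> nat, forall i, i \in J -> lt v a -> forall x,
    x i = range_point (b v) -> (forall i, if i \in J then scale_set (x i) else x i = p i) ->
    \forall n \near \oo, exists2 i, (i < f n)%N & U n i x.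
  move=> v.
  have /choice[f fP] : forall i, exists f : nat -> nat, i \in J -> forall x,
    x i = range_point (b v) -> (forall i, if i \in J then scale_set (x i) else x i = p i) ->
    \forall n \near \oo, exists2 i, (i < f n)%N & U n i x.
    move=> i; have [iJ|] := boolP (i \in J); last by exists id.
    have [||n x xP|f fP] := IH (J :\ i)
      (fun j => if j == i then range_point (b v) else p j) _ U.
    - move: Jk; rewrite (cardsD1 i) iJ add1n ltnS; exact: leq_trans.
    - exact: oU.
    - apply: covU => j; have := xP j; rewrite !inE.
      case: eqVneq => [->|] //=; rewrite iJ => ->; right; by exists v.
    - exists f => _ x xi xP; apply: fP => j; have := xP j; rewrite !inE.
      by case: eqVneq => [->|] //=; rewrite xi.
  exists (fun n => \max_i f i n) => i iJ _ x xi xP.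
  near=> n; have [j jf Ux] : exists2 j, (j < f i n)%N & U n j x.
    by near: n; exact: fP.
  exists j => //; apply: leq_trans jf _; exact: (@leq_bigmax _ (fun i => f i n)).
have [g gP] := scale_small bscale a f.
(* [g] serves the points with a free coordinate indexed before [a], and [h (s n)] all the others. *)
exists (fun n => maxn (g n) (h (s n))) => x xP.
have [[i [iJ [v [va xi]]]]|nx] := pselect (exists i, i \in J /\
    exists v, lt v a /\ x i = range_point (b v)).
  near=> n; have [j jf Ux] : exists2 j, (j < f v n)%N & U n j x.
    by near: n; apply: (fP v i).
  exists j => //; rewrite leq_max; apply/orP; left; apply: leq_trans jf _.
  by near: n; exact: gP.
(* For an index [w] not before [a], eventually [h n < b a n <= b w n], so the range of [b w] has at
   most [n] elements below [h n]. *)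
have good i : i \in J -> \forall n \near \oo, (h n < b a n)%N -> (cnt (x i) (h n) <= n)%N.
  move=> iJ; have := xP i; rewrite iJ => -[[m xm]|[w xw]].
    exists m => // n /= mn _; exact: leq_trans mn.
  have baw : b a <=* b w.
    have [aw|<-|wa] := scale_total bscale a w; first exact: (scale_mono bscale).
      by exists 0%N.
    by case: nx; exists i; split => //; exists w.
  near=> n => hn; rewrite xw; apply: cnt_range_point; first exact: (scale_incr bscale).
  by apply: leq_trans (ltnW hn) _; near: n.
have [N _ NP] : \forall n \near \oo, forall i, i \in J -> (h n < b a n)%N ->
    (cnt (x i) (h n) <= n)%N.
  apply: filter_forall => i; have [iJ|] := boolP (i \in J); last by exists 0%N.
  by apply: filterS (good i iJ) => n /= + _; apply.
exists N => // n /= Nn; have [ns hs] := sP n.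
have [|i ih Ux] := hP (s n) n ns x; last by exists i => //; rewrite leq_max ih orbT.
move=> i; have := xP i; case: ifPn => // iJ _.
by apply: NP => //=; exact: leq_trans Nn ns.
Unshelve. all: by end_near. Qed.

Lemma Hurewicz_enum_scale_power : Hurewicz_enum [set x | forall i, scale_set (x i)].
Proof.
move=> U oU cU; have [|f fP] := Hurewicz_enum_box [set: I]%SET (fun=> xpred0) U oU.
  by move=> n x xP; apply: cU => i; have := xP i; rewrite inE.
by exists f => x xP; apply: fP => i; rewrite inE; exact: xP.
Qed.

End Scale.
End FinitePowers.

Arguments agree {I}.
Arguments cylinder_open {I}.
Arguments Hurewicz_enum {I}.

(** * Perfect subsets of the Cantor space *)

Lemma countable_sub_range {S : countType} {T : Type} (g : S -> T) (A : set T) :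
  A `<=` range g -> countable A.
Proof.
move=> Ag; apply: (@sub_countable _ _ A [set: S]) (countableP _).
exact: card_le_trans (subset_card_le Ag) (card_image_le _ _).
Qed.

Lemma subset_countable {T : Type} (A B : set T) :
  A `<=` B -> countable B -> countable A.
Proof. by move=> /subset_card_le; exact: sub_countable. Qed.

Lemma countable_inj_image {T U : Type} (f : T -> U) (A : set T) :
  {in A &, injective f} -> countable (f @` A) -> countable A.
Proof.
move=> finj /countable_injP[h hinj]; apply/countable_injP; exists (h \o f).
move=> x y xA yA /= hxy; apply: finj => //; apply: hinj hxy; rewrite inE.
  by exists x => //; exact: set_mem.
by exists y => //; exact: set_mem.
Qed.

Lemma countable_setU {T : Type} (A B : set T) :
  countable A -> countable B -> countable (A `|` B).
Proof.
by move=> cA cB; rewrite -bigcup2E; apply: bigcup_countable => // -[|[|n]] _ //=.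
Qed.

Lemma finitely_supportedPn x :
  ~ finitely_supported x -> forall m, exists M, (m < cnt x M)%N.
Proof.
move=> nx m; apply: contrapT => /forallNP h; apply: nx; exists m => M.
by rewrite leqNgt; apply/negP; exact: h.
Qed.

(** A bounded count attains its maximum at some [N], after which no element occurs; the first [N]
    bits then determine the point. *)
Lemma countable_finitely_supported : countable finitely_supported.
Proof.
apply: (@countable_sub_range _ _ (fun s : seq bool => nth false s)) => x [m xm].
have [N Nmax] : exists N, forall M, (cnt x M <= cnt x N)%N.
  have [|k kb|_ /asboolP[N _ <-] Nmax] := @ex_maxnP (fun k => `[< range (cnt x) k >]) m.
  - by exists (cnt x 0); apply/asboolP; exists 0%N.
  - by move/asboolP: kb => [M _ <-]; exact: xm.
  - by exists N => M; apply: Nmax; apply/asboolP; exists M.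
exists (mkseq x N) => //; apply: funext => i.
have [iN|Ni] := ltnP i N; first by rewrite nth_mkseq.
rewrite nth_default ?size_mkseq//; case: (boolP (x i)) => // xi.
have := Nmax i.+1; rewrite cntS xi addn1 ltnNge => /negP; case.
exact: cnt_leq.
Qed.

Lemma exists_neq (x y : nat -> bool) : x <> y -> exists j, x j != y j.
Proof.
move=> xy; apply: contrapT => /forallNP h; apply: xy; apply: funext => j.
by apply/eqP; rewrite -(negbK (_ == _)); apply/negP; exact: h.
Qed.

Section PerfectSet.
Variable C : set (nat -> bool).
Hypothesis Cclosed : forall x,
  (forall L, exists2 y, C y & forall n, (n < L)%N -> y n = x n) -> C x.
Hypothesis Cunc : ~ countable C.

Let cyl (x : nat -> bool) m : set (nat -> bool) :=
  [set y | forall i, (i < m)%N -> y i = x i].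

(** Finite sets are discarded, at the cost of countably many points, so that every branch of the
    tree below can always gain a new element. *)
Let condensation : set (nat -> bool) := [set x | [/\ C x, ~ finitely_supported x &
  forall m, ~ countable (C `&` cyl x m)]].

Let countable_nocondensation : countable (C `\` condensation).
Proof.
pose A (s : seq bool) : set (nat -> bool) := C `&` cyl (nth false s) (size s).
pose B s := [set x | countable (A s) /\ A s x].
apply: (@subset_countable _ _ (finitely_supported `|` \bigcup_s B s)).
  move=> x [Cx nx].
  have [fx|fx] := pselect (finitely_supported x); first by left.
  right; have [m cm] : exists m, countable (C `&` cyl x m).
    apply: contrapT => /forallNP h; apply: nx; split => //.
  exists (mkseq x m) => //; have AE : A (mkseq x m) = C `&` cyl x m.
    rewrite /A size_mkseq; congr (_ `&` _); apply/seteqP.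
    by split=> y h i im; have := h i im; rewrite nth_mkseq.
  by rewrite /B /= AE; split.
apply: countable_setU; first exact: countable_finitely_supported.
apply: bigcup_countable; first exact: countableP.
move=> s _; have [cA|nA] := pselect (countable (A s)).
  by apply: subset_countable cA => x [].
by apply: subset_countable (countable0 _) => x [].
Qed.

Let condensation_uncountable (D : set (nat -> bool)) :
  ~ countable (C `&` D) -> ~ countable (condensation `&` D).
Proof.
move=> nD cD; apply: nD.
apply: subset_countable (countable_setU _ _ cD countable_nocondensation) => x [Cx Dx].
by have [|] := pselect (condensation x); [left|right].
Qed.

Let branching x m : condensation x -> exists y m', [/\ condensation y,
  cyl x m y, (m < m')%N, (cnt x m < cnt x m')%N /\ (cnt y m < cnt y m')%N &
  exists2 j, (j < m')%N & x j != y j].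
Proof.
move=> cx; have [Cx fx cndx] := cx.
have [y [cy xy nxy]] : exists y, [/\ condensation y, cyl x m y & x <> y].
  apply: contrapT => /forallNP h; apply: (condensation_uncountable _ (cndx m)).
  apply: subset_countable (countable1 x) => y [cy xy].
  by apply: contrapT => nyx; apply: (h y); split => // /esym.
have [j xyj] := exists_neq _ _ nxy.
have [M1 M1P] := finitely_supportedPn _ fx (cnt x m).
have [_ fy _] := cy; have [M2 M2P] := finitely_supportedPn _ fy (cnt y m).
(* [M1] and [M2] give each point a new element, [m.+1] raises the level, and [j.+1] makes the
   difference visible. *)
exists y, (maxn (maxn M1 M2) (maxn m.+1 j.+1)); split=> //.
- by rewrite !leq_max leqnn orbT.
- split; [apply: leq_trans M1P _|apply: leq_trans M2P _];
    by apply: cnt_leq; rewrite !leq_max leqnn ?orbT.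
- by exists j => //; rewrite !leq_max leqnn !orbT.
Qed.

(** A binary tree of condensation points is built in which every step adds an element to each
    branch. Each stage has finitely many nodes, so one [g] bounds their levels. *)
Lemma perfect_subset : exists (p : (nat -> bool) -> (nat -> bool)) (g : nat -> nat),
  [/\ injective p, forall y, C (p y) & forall y n, (n <= cnt (p y) (g n))%N].
Proof.
have [z0 z0c] : exists z, condensation z.
  apply: contrapT => /forallNP h; apply: (condensation_uncountable setT).
    by rewrite setIT.
  by apply: subset_countable (countable0 _) => x [/h].
have /choice[f fP] : forall xm : (nat -> bool) * nat, exists ym : (nat -> bool) * nat,
    condensation xm.1 -> [/\ condensation ym.1, cyl xm.1 xm.2 ym.1, (xm.2 < ym.2)%N,
    (cnt xm.1 xm.2 < cnt xm.1 ym.2)%N /\ (cnt ym.1 xm.2 < cnt ym.1 ym.2)%N &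
    exists2 j, (j < ym.2)%N & xm.1 j != ym.1 j].
  move=> [x m]; have [/branching|nx] := pselect (condensation x); last by exists (x, m).
  by move=> /(_ m)[y [m' ?]]; exists (y, m').
(* A node is a point with the level up to which its digits are final. The bit keeps the point or
   moves to its partner; both children get the same level. *)
pose step (xm : (nat -> bool) * nat) (c : bool) :=
  (if c then xm.1 else (f xm).1, (f xm).2).
pose node := fix node (y : nat -> bool) n :=
  if n is n'.+1 then step (node y n') (y n') else (z0, 0%N).
have nodeC y n : condensation (node y n).1.
  elim: n => //= n IH; case: (y n) => //; by have [] := fP _ IH.
have nodeS y n : [/\ cyl (node y n).1 (node y n).2 (node y n.+1).1,
    ((node y n).2 < (node y n.+1).2)%N &
    (cnt (node y n).1 (node y n).2 < cnt (node y n.+1).1 (node y n.+1).2)%N].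
  have [_ h2 h3 [h4 h5] _] := fP _ (nodeC y n).
  split => //=; first by case: (y n).
  by case: (y n) => //; rewrite -(eq_cnt (f (node y n)).1).
have node_ge y n : (n <= (node y n).2)%N.
  by elim: n => // n IH; have [_ h _] := nodeS y n; exact: leq_ltn_trans IH h.
have node_agree y n k : (n <= k)%N -> cyl (node y n).1 (node y n).2 (node y k).1 /\
    ((node y n).2 <= (node y k).2)%N.
  elim: k => [|k IH]; first by rewrite leqn0 => /eqP ->; split.
  rewrite leq_eqVlt => /orP[/eqP <-|]; first by split.
  rewrite ltnS => /IH[h1 h2]; have [h3 h4 _] := nodeS y k.
  split; last exact: leq_trans (ltnW h4).
  by move=> i im; rewrite h3 ?h1//; exact: leq_trans im h2.
(* The level of stage [i.+1] is at least [i.+1], so digit [i] is already final there. *)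
pose p y i := (node y i.+1).1 i.
have pnode y n : cyl (node y n).1 (node y n).2 (p y).
  move=> i im; rewrite /p.
  have [ni|ni] := leqP n i.+1; first by rewrite (node_agree y n i.+1 ni).1.
  by rewrite (node_agree y i.+1 n (ltnW ni)).1// node_ge.
have [g gP] : exists g : nat -> nat, forall n y, ((node y n).2 <= g n)%N.
  suff /choice[g gP] : forall n, exists g, forall y, ((node y n).2 <= g)%N by exists g.
  move=> n; have fn : finite_set [set node y n | y in setT].
    elim: n => [|n IH].
      by apply: sub_finite_set (finite_set1 (z0, 0%N)) => _ [y _ <-].
    apply: sub_finite_set (finite_image2 step IH (@finite_finset _ [set: bool])).
    move=> _ [y _ <-]; exists (node y n); first by exists y.
    by exists (y n).
  have fn2 := finite_image snd fn.
  exists (\max_(k <- finmap.enum_fset (fset_set (snd @` [set node y n | y in setT]))) k) => y.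
  apply: (@leq_bigmax_seq _ _ xpredT id) => //.
  by rewrite in_fset_set// inE /=; exists (node y n) => //; exists y.
exists p, g; split.
(* Equal bits below [n] lead to the same node. Different bits at [n] would give children that differ
   below their common level, where [p] copies their digits. *)
- move=> y y' pyy'.
  suff H n : forall k, (k < n)%N -> y k = y' k by apply: funext => k; exact: (H k.+1).
  elim: n => // n IH k; rewrite ltnS leq_eqVlt => /orP[/eqP ->|]; last exact: IH.
  have nn : node y n = node y' n.
    elim: n IH {k} => //= n IHn IH; rewrite IHn ?IH// => k kn; exact: IH (ltnW kn).
  apply: contrapT => ynn.
  have [_ _ _ _ [j jm]] := fP _ (nodeC y n).
  have := pnode y n.+1 j; have := pnode y' n.+1 j; rewrite pyy' /= -nn => /(_ jm) -> /(_ jm).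
  by move: ynn; case: (y n); case: (y' n) => // _ ->; rewrite eqxx.
- move=> y; apply: Cclosed => L; exists (node y L).1; first by have [] := nodeC y L.
  by move=> n nL; rewrite (pnode y L)//; exact: leq_trans (node_ge y L).
- move=> y n; apply: (@leq_trans (cnt (p y) (node y n).2)); last exact: cnt_leq.
  rewrite (eq_cnt _ (node y n).1); last exact: pnode.
  by elim: n => // n IH; have [_ _] := nodeS y n; exact: leq_ltn_trans.
Qed.

End PerfectSet.

(** * Embedding into the real line *)

Section TernaryEmbedding.
Context {R : realType}.
Local Open Scope ring_scope.
Implicit Types x y : nat -> bool.

(** Digits 0 and 1 with weights starting at 1 give the usual Cantor set scaled by [3 / 2], which is
    also the constant in the tail bound. *)
Let psum x n : R := \sum_(i < n) (x i)%:R * 3^-1 ^+ i.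

Let psum_mono x n m : (n <= m)%N ->
  psum x n <= psum x m <= psum x n + 3 / 2 * (3^-1 ^+ n - 3^-1 ^+ m).
Proof.
elim: m => [|m IH]; first by rewrite leqn0 => /eqP ->; rewrite subrr mulr0 addr0 lexx.
rewrite leq_eqVlt => /orP[/eqP <-|]; first by rewrite subrr mulr0 addr0 lexx.
rewrite ltnS => /IH/andP[h1 h2].
have e0 : 0 < 3^-1 ^+ m :> R by rewrite exprn_gt0// invr_gt0.
have E : psum x m.+1 = psum x m + (x m)%:R * 3^-1 ^+ m by rewrite /psum big_ord_recr.
rewrite E exprS; move: h1 h2 e0; set e := 3^-1 ^+ m; set d := 3^-1 ^+ n.
by case: (x m) => /=; rewrite ?mul1r ?mul0r; move: (psum x m) (psum x n) => a c; lra.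
Qed.

Definition ternary x : R := sup (range (psum x)).

Lemma ternary_bounds x n : psum x n <= ternary x <= psum x n + 3 / 2 * 3^-1 ^+ n.
Proof.
have ub : ubound (range (psum x)) (psum x n + 3 / 2 * 3^-1 ^+ n).
  move=> _ [m _ <-]; have e0 k : 0 < 3^-1 ^+ k :> R by rewrite exprn_gt0// invr_gt0.
  have := e0 n; have := e0 m.
  have [nm|/ltnW mn] := leqP n m.
    by have /andP[] := psum_mono x _ _ nm; lra.
  by have /andP[] := psum_mono x _ _ mn; lra.
apply/andP; split.
  by apply: ub_le_sup; [exists (psum x n + 3 / 2 * 3^-1 ^+ n)|exists n].
by apply: ge_sup => //; exists (psum x 0), 0%N.
Qed.

Let eq_psum x y n : (forall i, (i < n)%N -> x i = y i) -> psum x n = psum y n.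
Proof. by move=> xy; apply: eq_bigr => i _; rewrite xy. Qed.

Lemma ternary_close x y n : (forall i, (i < n)%N -> x i = y i) ->
  `|ternary x - ternary y| <= 3 / 2 * 3^-1 ^+ n.
Proof.
move=> /eq_psum xy; have := ternary_bounds x n; have := ternary_bounds y n.
by rewrite xy => /andP[? ?] /andP[? ?]; rewrite ler_norml; apply/andP; split; lra.
Qed.

(** At the first difference [n] one side gains [3^-n], while all later digits of the other
    contribute at most half of that. *)
Lemma ternary_inj : injective ternary.
Proof.
suff H x y n : (forall i, (i < n)%N -> x i = y i) -> x n -> ~~ y n -> ternary y < ternary x.
  move=> x y exy; apply: contrapT => nxy.
  have [j xyj] := exists_neq _ _ nxy.
  have [n xyn nmin] := @ex_minnP (fun j => x j != y j) (ex_intro _ j xyj).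
  have xy i : (i < n)%N -> x i = y i.
    move=> ni; apply/eqP; rewrite -(negbK (_ == _)); apply/negP => /nmin.
    by rewrite leqNgt ni.
  case: (boolP (x n)) => xn; case: (boolP (y n)) => yn.
  - by move: xyn; rewrite xn yn.
  - by have := H x y n xy xn yn; rewrite exy ltxx.
  - by have := H y x n (fun i ni => esym (xy i ni)) yn xn; rewrite exy ltxx.
  - by move: xyn; rewrite (negbTE xn) (negbTE yn).
move=> xy xn yn.
have /andP[h1 _] := ternary_bounds x n.+1.
have /andP[_ h2] := ternary_bounds y n.+1.
have e0 : 0 < 3^-1 ^+ n :> R by rewrite exprn_gt0// invr_gt0.
have Ex : psum x n.+1 = psum x n + 3^-1 ^+ n by rewrite /psum big_ord_recr /= xn mul1r.
have Ey : psum y n.+1 = psum y n by rewrite /psum big_ord_recr /= (negbTE yn) mul0r addr0.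
by move: h1 h2; rewrite Ex Ey (eq_psum _ _ _ xy) exprS; lra.
Qed.

Lemma cvg_ternary (u : nat -> nat -> bool) x :
  (forall n i, (i < n)%N -> u n i = x i) -> ternary (u n) @[n --> \oo] --> ternary x.
Proof.
move=> ux; apply/cvgrPdist_le => e e0.
have c0 : (3 / 2 * 3^-1 ^+ n : R) @[n --> \oo] --> (3 / 2 * 0 : R).
  by apply: cvgMr; apply: cvg_expr; rewrite ger0_norm ?invr_ge0// invf_lt1// ltr1n.
rewrite mulr0 in c0; move/cvgrPdist_le: c0 => /(_ _ e0); apply: filterS => n.
rewrite sub0r normrN => h; apply: le_trans (le_trans (ler_norm _) h).
by apply: ternary_close => i ni; rewrite ux.
Qed.

(** Continuity by sequences: counterexamples agreeing with [x] to every depth would have images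
    converging coordinatewise to the image of [x]. *)
Lemma ternary_open (k : nat) (O : set {ptws 'I_k -> R}) : open O ->
  cylinder_open [set x : 'I_k -> nat -> bool | O (fun i => ternary (x i))].
Proof.
move=> oO x Ox; apply: contrapT => /forallNP h.
have /choice[u uP] : forall L, exists y : 'I_k -> nat -> bool, agree L x y /\ ~ O (fun i => ternary (y i)).
  by move=> L; have /existsNP[y /not_implyP[]] := h L; exists y.
pose v n : {ptws 'I_k -> R} := fun i => ternary (u n i).
have vx : v @ \oo --> ((fun i => ternary (x i)) : {ptws 'I_k -> R}).
  apply/cvg_sup => i; have surj : range (fun f : 'I_k -> R => f i) = setT.
    by apply/seteqP; split => // r _; exists (fun=> r).
  apply/cvg_image => // B nB; exists [set f | B (f i)].
    apply: (cvg_ternary (fun n => u n i) (x i) _ _ nB) => n j jn.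
    by rewrite (uP n).1.
  exact: image_preimage surj.
have [N _ NO] := vx _ (open_nbhs_nbhs (conj oO Ox)).
exact: (uP N).2 (NO N (leqnn N)).
Qed.
End TernaryEmbedding.

(** * Compact subsets and Hurewicz covers *)

Section ScaleSet.
Variables (W : Type) (lt : W -> W -> Prop) (b : W -> nat -> nat).
Hypothesis bscale : scale lt b.

Lemma range_point_scale_ltn w n M : (n < cnt (range_point (b w)) M)%N -> (b w n < M)%N.
Proof.
move=> h; rewrite ltnNge; apply/negP => Mb.
have := cnt_range_point _ _ _ (scale_incr bscale w) Mb.
by rewrite leqNgt h.
Qed.

(** If the set were countable, a single function would dominate the enumerations of all its infinite
    members, among them every [b w]. *)
Lemma uncountable_scale_set : ~ countable (scale_set W b).
Proof.
move=> /countable_injP[phi phi_inj].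
have /choice[F FP] : forall i, exists f : nat -> nat, forall x, scale_set W b x ->
    ~ finitely_supported x -> phi x = i -> forall n, (n < cnt x (f n))%N.
  move=> i; have [[x [xb xf xi]]|h] := pselect (exists x,
      [/\ scale_set W b x, ~ finitely_supported x & phi x = i]).
    have /choice[f fP] := finitely_supportedPn _ xf.
    exists f => y yb yf yi; suff -> : y = x by [].
    by apply: phi_inj; rewrite ?inE// yi xi.
  by exists id => x xb xf xi; case: h; exists x.
have [g gP] := countable_family_dominated F.
have [w nw] := scale_unbounded bscale g; apply: nw.
set x := range_point (b w).
have xf : ~ finitely_supported x.
  move=> [m xm]; have [M] := range_point_unbounded (b w) m (scale_incr bscale w).
  by rewrite ltnNge xm.
have xF := FP (phi x) x (or_intror (ex_intro _ w erefl)) xf erefl.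
near=> n; apply: (@leq_trans (F (phi x) n)).
  by apply: ltnW; apply: range_point_scale_ltn; exact: xF.
by near: n; exact: gP.
Unshelve. all: by end_near. Qed.

(* An uncountable closed subset would contain a copy of the Cantor set whose
   points have indices before some fixed [a], making the initial segment below
   [a] as large as the whole of [nat -> nat]. *)
Lemma countable_closed_scale_set (C : set (nat -> bool)) :
  (forall x, (forall L, exists2 y, C y & forall n, (n < L)%N -> y n = x n) -> C x) ->
  C `<=` scale_set W b -> countable C.
Proof.
move=> Ccl Cb; apply: contrapT => /(perfect_subset _ Ccl)[p [g [pinj pC pg]]].
have /choice[al alP] : forall y, exists w, p y = range_point (b w).
  move=> y; have [[m ym]|//] := Cb _ (pC y).
  by have := leq_trans (pg y m.+1) (ym _); rewrite ltnn.
have al_inj : injective al.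
  by move=> y y' h; apply: pinj; rewrite !alP h.
(* The shift is needed because having [n.+1] elements below [g n.+1] places the element numbered
   [n], counted from 0, below it. *)
have [a na] := scale_unbounded bscale (fun n => g n.+1).
have bal y n : (b (al y) n <= g n.+1)%N.
  by apply: ltnW; apply: range_point_scale_ltn; rewrite -alP; exact: pg.
have al_lt y : lt (al y) a.
  have [//|ya|ay] := scale_total bscale (al y) a; case: na.
    by exists 0%N => // n _; rewrite -ya bal.
  by apply: filterS (scale_mono bscale _ _ ay) => n /leq_trans; apply.
(* Coding a function by its graph injects [nat -> nat] into the Cantor space, so each function gets
   its own index below [a]. By [scale_small] one [h] would then dominate all functions. *)
pose code (F : nat -> nat) (m : nat) : bool :=
  if (unpickle m : option (nat * nat)) is Some ij then F ij.1 == ij.2 else false.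
have code_inj : injective code.
  move=> F F' FF'; apply: funext => i.
  have := congr1 (fun c => c (pickle (i, F i))) FF'.
  by rewrite /code pickleK /= eqxx => /esym/eqP.
have /choice[G GP] : forall v, exists f : nat -> nat, forall F, al (code F) = v -> F = f.
  move=> v; have [[F0 F0v]|h] := pselect (exists F, al (code F) = v).
    by exists F0 => F Fv; apply: code_inj; apply: al_inj; rewrite Fv F0v.
  by exists id => F Fv; case: h; exists F.
have [h hP] := scale_small bscale a G.
pose F n := (h n).+1.
have := hP _ (al_lt (code F)); rewrite -(GP _ F erefl) => -[N _ /(_ N (leqnn N))].
by rewrite /= /F ltnn.
Qed.

End ScaleSet.

(** * Hurewicz covers of the finite powers in the line *)

Section HurewiczCovers.
Variables (T : topologicalType) (A : set T).

Lemma ropen_bigcup (F : set (set T)) : F `<=` ropen A -> ropen A (\bigcup_(V in F) V).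
Proof.
move=> Fo; exists (\bigcup_(O in [set O | open O /\ F (A `&` O)]) O); split.
  by apply: bigcup_open => O [].
apply/seteqP; split => [x [V FV Vx]|x [Ax [Q [oQ FQ] Qx]]].
  have [Q [oQ VE]] := Fo _ FV; move: FV Vx; rewrite VE => FQ [Ax Qx].
  by split => //; exists Q.
by exists (A `&` Q).
Qed.

(** If the range were finite, one union [S] would recur infinitely often. Having no finite subcover,
    [S] misses a point, which would then be missed infinitely often. *)
Lemma point_cofinite_cover_range (U F : nat -> set (set T)) :
  (forall n, open_cover A (U n) /\ no_finite_subcover A (U n)) ->
  (forall n, F n `<=` U n /\ finite_set (F n)) ->
  (forall x, A x -> \forall n \near \oo, (\bigcup_(V in F n) V) x) ->
  point_cofinite_cover A (range (fun n => \bigcup_(V in F n) V)).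
Proof.
move=> UP FP cof; split; [split|split].
- move=> _ [n _ <-]; apply: ropen_bigcup => V /(FP n).1; exact: (UP n).1.1.
- move=> x /cof[N _ /(_ N (leqnn N)) h].
  by exists (\bigcup_(V in F N) V) => //; exists N.
- move=> /finite_range_cst_subsequence[S [B Binf BS]].
  have [y Ay nSy] : exists2 y, A y & ~ S y.
    have [n Bn] : exists n, B n by exact: infinite_setN0.
    have /BS <- := Bn; apply: contrapT => h; apply: (UP n).2.
    exists (F n); split; [exact: (FP n).1|split; first exact: (FP n).2].
    move=> y Ay; apply: contrapT => ny; apply: h; by exists y.
  have [N _ NP] := cof _ Ay.
  apply: Binf; apply: sub_finite_set (finite_II N) => n Bn /=.
  rewrite ltnNge; apply/negP => Nn; apply: nSy.
  by have /BS <- := Bn; exact: NP.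
- move=> x /cof[N _ NP].
  apply: sub_finite_set (finite_image (fun n => \bigcup_(V in F n) V) (finite_II N)).
  move=> _ [[n _ <-] nx]; exists n => //=; rewrite ltnNge; apply/negP => Nn.
  by apply: nx; exact: NP.
Qed.

End HurewiczCovers.

Section Powers.
Variables (R : realType) (k : nat) (Z : set (nat -> bool)).
Let X : set R := ternary @` Z.

Let powerE (f : {ptws 'I_k -> R}) : power X k f ->
  exists2 x : 'I_k -> nat -> bool, (forall i, Z (x i)) & f = (fun i => ternary (x i)).
Proof.
move=> Xf; have /choice[x xP] : forall i, exists x, Z x /\ ternary x = f i.
  by move=> i; have [x Zx <-] := Xf i; exists x.
exists x => [i|]; first exact: (xP i).1.
by apply: funext => i; rewrite (xP i).2.
Qed.

(** There are countably many tuples of finite bit strings. For each one a member of [U] containing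
    the image of its cylinder is chosen if there is any, and the default [V0] otherwise. *)
Lemma countable_subcover_power (U : set (set {ptws 'I_k -> R})) :
  open_cover (power X k) U -> no_finite_subcover (power X k) U ->
  exists V : nat -> set {ptws 'I_k -> R},
    (forall i, U (V i)) /\ power X k `<=` \bigcup_i V i.
Proof.
move=> [Uo Uc] nf.
have [V0 UV0] : exists V, U V.
  apply: contrapT => /forallNP h; apply: nf; exists set0; split => //; split => //.
  by move=> f /Uc[V /h].
pose good (s : {ffun 'I_k -> seq bool}) (V : set {ptws 'I_k -> R}) :=
  forall x : 'I_k -> nat -> bool, (forall i, Z (x i)) ->
    (forall i n, (n < size (s i))%N -> x i n = nth false (s i) n) ->
    V (fun i => ternary (x i)).
have /choice[G GP] : forall s, exists V, U V /\ ((exists2 V', U V' & good s V') -> good s V).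
  move=> s; have [[V UV sV]|h] := pselect (exists2 V', U V' & good s V').
    by exists V.
  by exists V0.
exists (fun i => odflt V0 (omap G (unpickle i))); split.
  by move=> i; case: unpickle => //= s; exact: (GP s).1.
move=> f Xf; have [x Zx fE] := powerE _ Xf.
have [V UV Vf] := Uc _ Xf.
have [Q [oQ VE]] := Uo _ UV.
have [L LP] : exists L, forall y : 'I_k -> nat -> bool, agree L x y ->
    Q (fun i => ternary (y i)).
  by apply: (ternary_open k Q oQ x); move: Vf; rewrite VE fE => -[].
pose s : {ffun 'I_k -> seq bool} := [ffun i => mkseq (x i) L].
have sV : good s V.
  move=> y Zy ys; rewrite VE; split; first by move=> i; exists (y i).
  apply: LP => i n nL; rewrite ys /s ffunE ?size_mkseq//.
  by rewrite nth_mkseq.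
exists (pickle s) => //; rewrite pickleK /= fE; apply: (GP s).2 => //; first by exists V.
by move=> i n; rewrite /s ffunE size_mkseq => nL; rewrite nth_mkseq.
Qed.

Lemma Hurewicz_power :
  Hurewicz_enum [set x : 'I_k -> nat -> bool | forall i, Z (x i)] -> Hurewicz (power X k).
Proof.
move=> HZ U UP.
have /choice[V VP] : forall n, exists V : nat -> set {ptws 'I_k -> R},
    (forall i, U n (V i)) /\ power X k `<=` \bigcup_i V i.
  by move=> n; apply: countable_subcover_power; [exact: (UP n).1|exact: (UP n).2].
have /choice[Q QP] : forall ni : nat * nat, exists Q : set {ptws 'I_k -> R},
    open Q /\ V ni.1 ni.2 = power X k `&` Q.
  by move=> [n i]; exact: (UP n).1.1 _ ((VP n).1 i).
have [||f fP] := HZ (fun n i => [set x | Q (n, i) (fun j => ternary (x j))]).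
- by move=> n i; apply: ternary_open; exact: (QP (n, i)).1.
- move=> n x Zx; have Xx : power X k (fun j => ternary (x j)) by move=> j; exists (x j).
  have [i _] := (VP n).2 _ Xx; rewrite (QP (n, i)).2 => -[_ Qx].
  by exists i.
have FU n : [set V n i | i in `I_(f n)] `<=` U n /\ finite_set [set V n i | i in `I_(f n)].
  split; first by move=> _ [i _ <-]; exact: (VP n).1.
  exact: finite_image (finite_II _).
exists (fun n => [set V n i | i in `I_(f n)]); split => //.
apply: (point_cofinite_cover_range _ _ U) => // h Xh.
have [x Zx hE] := powerE _ Xh.
apply: filterS (fP x Zx) => n [i ifn Qx].
exists (V n i); first by exists i.
by rewrite (QP (n, i)).2; split => //; rewrite hE.
Qed.

End Powers.

(** * Michael's line *)

(* The points of [X] are isolated, the others keep their usual neighbourhoods. *)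
Definition isolate {R : realType} (X : set R) : Type := R.

Section Isolate.
Context {R : realType} (X : set R).

HB.instance Definition _ := Choice.on (isolate X).

Let op : set (set (isolate X)) :=
  [set O | forall x : R, O x -> ~ X x -> nbhs x (O : set R)].

Let opT : op setT.
Proof. by move=> x _ _; exact: filterT. Qed.

Let opI : setI_closed op.
Proof. by move=> V1 V2 h1 h2 x [V1x V2x] nX; apply: filterI; [exact: h1|exact: h2]. Qed.

Let op_bigU (I : Type) (f : I -> set (isolate X)) :
  (forall i, op (f i)) -> op (\bigcup_i f i).
Proof.
move=> h x [i _ fix_] nX; apply: filterS (h i x fix_ nX) => y fy; by exists i.
Qed.

HB.instance Definition _ := isOpenTopological.Build (isolate X) opT opI op_bigU.

Lemma open_isolateP (O : set (isolate X)) :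
  open O <-> forall x : R, O x -> ~ X x -> nbhs x (O : set R).
Proof. by []. Qed.

Lemma nbhs_isolate (x : R) (B : set R) : nbhs x B -> nbhs (x : isolate X) B.
Proof.
rewrite nbhsE => -[V [oV Vx] VB]; rewrite nbhsE; exists V => //; split => //.
by apply/open_isolateP => y Vy _; exact: open_nbhs_nbhs.
Qed.

End Isolate.

Section CountableCompacts.
Variables (R : realType) (X : set R).
Hypothesis countable_compact : forall K : set R, K `<=` X -> compact K -> countable K.

Lemma countable_closed_subset (D : set R) : D `<=` X -> closed D -> countable D.
Proof.
move=> DX Dcl.
have -> : D = \bigcup_n (`[- n%:R, n%:R] `&` D)%R.
  apply/seteqP; split => [x Dx|x [n _ []]//].
  exists (Num.truncn `|x|).+1 => //; split=> //=.
  rewrite in_itv /= -ler_norml; apply: ltW; exact: truncnS_gt.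
apply: bigcup_countable => // n _; apply: countable_compact.
  by move=> x [_ /DX].
by apply: compact_closedI => //; exact: segment_compact.
Qed.

(** The usual interiors of the members have a union [E] containing all points outside [X]. Its
    complement is closed and inside [X], hence countable; rational intervals take care of [E]. *)
Lemma Lindelof_isolate : Lindelof [set: isolate X].
Proof.
move=> U [Uo Uc].
pose U' (V : set R) : Prop := U V.
have nU x : ~ X x -> exists2 V : set R, U' V & nbhs x V.
  move=> nX; have [V UV Vx] := Uc (x : isolate X) I.
  exists V => //; have [Q [oQ VE]] := Uo _ UV.
  rewrite /U' VE setTI in Vx *; exact: (iffLR (open_isolateP X Q) oQ).
pose E := \bigcup_(V in U') (interior V).
have oE : open E by apply: bigcup_open => V _; exact: open_interior.
have cD : countable (~` E).
  apply: countable_closed_subset; last exact: open_closedC.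
  move=> x nE; apply: contrapT => /nU[V UV nV]; apply: nE; by exists V.
have [V0 UV0 _] := Uc (0%R : R) I.
have /choice[f fP] : forall x : R, exists V, U' V /\ V x.
  by move=> x; have [V UV Vx] := Uc (x : isolate X) I; exists V.
have /choice[g gP] : forall q : rat * rat, exists V : set R, U' V /\
    ((exists2 V', U' V' & `]ratr q.1, ratr q.2[ `<=` V') -> `]ratr q.1, ratr q.2[ `<=` V).
  move=> q; have [[V UV qV]|h] := pselect (exists2 V', U' V' & `]ratr q.1, ratr q.2[ `<=` V').
    by exists V.
  by exists V0.
exists (f @` (~` E) `|` range g); split; [|split].
- by move=> V [[x _ <-]|[q _ <-]]; [exact: (fP x).1|exact: (gP q).1].
- apply: countable_setU; last by apply: (countable_sub_range g).
  by apply: sub_countable cD; exact: card_image_le.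
- move=> y0 _; pose x : R := y0; have [[V UV Vx]|nEx] := pselect (E x); last first.
    by exists (f x); [left; exists x|exact: (fP x).2].
  have [e /= e0 eV] := Vx.
  have [|q1 q1P] := @rat_in_itvoo R (x - e)%R x; first by rewrite ltrBlDr ltrDl.
  have [|q2 q2P] := @rat_in_itvoo R x (x + e)%R; first by rewrite ltrDl.
  exists (g (q1, q2)); first by right; exists (q1, q2).
  move: q1P q2P; rewrite !in_itv /= => /andP[h1 h2] /andP[h3 h4].
  apply: (gP (q1, q2)).2; last by rewrite /= in_itv /= h2 h3.
  exists V => // y; rewrite /= in_itv /= => /andP[h5 h6]; apply: eV.
  by rewrite /ball /= ltr_distlC (lt_trans h1 h5) (lt_trans h6 h4).
Qed.

Hypothesis uncountable : ~ countable X.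

(* The diagonal of [X] is an uncountable closed discrete subset of the product. *)
Lemma not_productively_Lindelof : ~ productively_Lindelof X.
Proof.
move=> /(_ _ Lindelof_isolate).
pose Y := isolate X.
set A := X `*` [set: Y].
(* For [x] in [X] the fibre is open because [x] is isolated in [Y], and it is the only member of the
   cover containing [(x, x)]. A subcover must keep all fibres. *)
pose fib x := A `&` [set p : R * Y | (p.2 : R) = x].
pose offdiag := A `&` [set p : R * Y | p.1 <> (p.2 : R)].
move=> /(_ [set V | V = offdiag \/ exists2 x, X x & V = fib x])[].
  split=> [V [->|[x Xx ->]]|p Ap].
  - exists [set p : R * Y | p.1 <> (p.2 : R)]; split => //.
    rewrite openE => -[r y] /= ry;
    have := @Rhausdorff R; rewrite open_hausdorff => /(_ r (y : R)) [|[B1 B2] /=].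
      exact/eqP.
    move=> [/set_mem B1r /set_mem B2y] [oB1 oB2 /eqP B12].
    exists (B1, B2).
      split; first exact: open_nbhs_nbhs.
      by apply: nbhs_isolate; exact: open_nbhs_nbhs.
    move=> [r' y'] /= [B1r' B2y'] ry'; have : (B1 `&` B2) r' by split => //; rewrite ry'.
    by rewrite B12.
  - exists [set p : R * Y | (p.2 : R) = x]; split => //.
    rewrite openE => -[r y] /= yx; exists (setT, [set y : Y | (y : R) = x]).
      split => /=; first exact: filterT.
      by apply: open_nbhs_nbhs; split => //; apply/open_isolateP => _ /= -> /(_ Xx).
    by case=> r' y' [].
  - have [pd|pd] := pselect (p.1 = (p.2 : R)).
      exists (fib p.1); last by split.
      by right; exists p.1 => //; exact: Ap.1.
    by exists offdiag; [left|split].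
move=> C [CU [cC cov]]; apply: uncountable.
apply: (countable_inj_image fib) => [x y /set_mem Xx _ fxy|].
  by have : fib x (x, x : Y) by []; rewrite fxy => -[].
apply: subset_countable cC => _ [x Xx <-].
have [V CV Vx] := cov (x, x : Y) (conj Xx I).
have [VE|[y Xy VE]] := CU _ CV.
  by move: Vx; rewrite VE => -[_] /(_ erefl).
by move: Vx CV; rewrite VE => -[_ /= ->].
Qed.

(* A closed subset of the line is a G-delta, so [X] is covered by its countable
   compact subsets. *)
Lemma not_Alster : ~ Alster X.
Proof.
move=> /(_ [set K | K `<=` X /\ compact K])[].
- move=> K [KX Kc].
  have Kcl : closed K by apply: compact_closed => //; exact: Rhausdorff.
  (* A closed set is the intersection of its neighbourhoods of radius [1 / (n + 1)]. *)
  exists (fun n => X `&` [set y | exists2 z, K z & ball z (n.+1%:R^-1 : R)%R y]); split.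
    move=> n; eexists; split; last reflexivity.
    rewrite (_ : mkset _ = \bigcup_(z in K) ball z (n.+1%:R^-1 : R)%R); last first.
      by apply/seteqP; split => y [z Kz zy]; exists z.
    by apply: bigcup_open => z Kz; exact: ball_open.
  apply/seteqP; split => [x Kx n _|x h].
    by split; [exact: KX|exists x => //; apply: ballxx].
  apply: Kcl => B [e /= e0 eB].
  have [n ne] : exists n, (n.+1%:R^-1 < e :> R)%R.
    by have [n _ /(_ n (leqnn n))] := near_infty_natSinv_lt (PosNum e0); exists n.
  have [_ [z Kz zx]] := h n I; exists z; split => //; apply: eB.
  by apply: le_ball (ltW ne) _ _; exact/ball_sym.
- by move=> x Xx; exists [set x] => //; split; [move=> _ ->|exact: compact_set1].
- by move=> K KX Kc; exists K.
- move=> C [CU [cC XC]]; apply: uncountable.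
  apply: subset_countable XC _; apply: bigcup_countable => // K /CU[KX Kc].
  exact: countable_compact.
Qed.

End CountableCompacts.

Theorem theorem2p5 (R : realType) :
  exists X : set R,
    (forall k : nat, (0 < k)%N -> Hurewicz (power X k)) /\
    ~ productively_Lindelof X /\ ~ Alster X.
Proof.
have [W [lt [b bscale]]] := exists_scale.
exists (ternary @` scale_set W b); set X := _ @` _.
have unc : ~ countable X.
  move=> cX; apply: (uncountable_scale_set _ _ _ bscale).
  by apply: countable_inj_image cX => x y _ _; exact: ternary_inj.
have cptc (K : set R) : K `<=` X -> compact K -> countable K.
  move=> KX Kc; have Kcl : closed K by apply: compact_closed => //; exact: Rhausdorff.
  have -> : K = ternary @` (ternary @^-1` K).
    apply/seteqP; split; last exact: image_preimage_subset.
    by move=> r Kr; have [x _ xr] := KX _ Kr; exists x => //=; rewrite xr.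
  have cZ : countable (ternary @^-1` K).
    apply: (countable_closed_scale_set _ _ _ bscale).
      move=> x xP; have /choice[u uP] : forall L, exists y,
          K (ternary y) /\ forall n, (n < L)%N -> y n = x n.
        by move=> L; have [y Ky yx] := xP L; exists y.
      apply: (closed_cvg K Kcl _ _ (cvg_ternary u x _)).
        by apply: nearW => n; exact: (uP n).1.
      by move=> n i; exact: (uP n).2.
    by move=> x /KX[y yb /ternary_inj <-].
  by apply: sub_countable cZ; exact: card_image_le.
split; last by split; [exact: not_productively_Lindelof|exact: not_Alster].
move=> k _; apply: Hurewicz_power; exact: Hurewicz_enum_scale_power bscale.
Qed.
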